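(* Let $t$ be arbitrary (including $t=0$). For $n\ge 0$ let $H_n$ be the $n\times n$ Hankel matrix with entries $(H_n)_{i,j}=f(i+j-2,t,2)$ for $1\le i,j\le n$, where $f(m,t,2)$ is the total weight of the lattice paths from $(0,0)$ to $(m,0)$ that never run below the $x$-axis and use the steps $U=(1,1)$, $H=(2,0)$, $D=(1,-1)$, each $H$ step having weight $t$ and each $U$ and $D$ step having weight $1$. Then for all $n\ge 0$, $$\det(H_n)=\begin{cases}(1+t)^{n^2/4} & \text{if } n \text{ is even},\\ (1+t)^{(n-1)(n+1)/4} & \text{if } n \text{ is odd}.\end{cases}$$
   Context: The weight of a path is the product of the weights of its steps; the weight of a set of paths is the sum of the weights of its paths. The path of length zero has weight $1$, so $f(0,t,2)=1$. The weight $t$ may be taken to be an arbitrary number or an indeterminate. Equivalently, $F(x)=\sum_{m\ge0}f(m,t,2)x^m$ satisfies $F(x)=1+tx^2F(x)+x^2F(x)^2$. The determinant of the $0\times 0$ matrix is $1$. *)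

(* Defs.v *)
From HB Require Import structures.
From mathcomp Require Import all_boot all_order all_algebra.

Set Implicit Arguments.
Unset Strict Implicit.
Unset Printing Implicit Defensive.

Import Order.TTheory GRing.Theory Num.Theory.
Local Open Scope ring_scope.

Inductive step := Up | Horizontal | Down.

Definition step_code (s : step) : option bool :=
  match s with Up => Some true | Horizontal => None | Down => Some false end.
Definition step_decode (c : option bool) : step :=
  match c with Some true => Up | None => Horizontal | Some false => Down end.
Lemma step_codeK : cancel step_code step_decode. Proof. by case. Qed.
HB.instance Definition _ := Finite.copy step (can_type step_codeK).

Definition step_vector (s : step) : int * int :=
  match s with Up => (1, 1) | Horizontal => (2, 0) | Down => (1, -1) end.

(* A path starting at (0, 0) is encoded by its sequence of steps. *)
Definition endpoint (p : seq step) : int * int :=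
  \sum_(s <- p) step_vector s.

Definition never_below_axis (p : seq step) : bool :=
  all (fun k => 0 <= (endpoint (take k p)).2) (iota 0 (size p).+1).

Definition is_path_to (m : nat) (p : seq step) : bool :=
  (endpoint p == (m%:Z, 0)) && never_below_axis p.

Definition step_weight (R : comNzRingType) (t : R) (s : step) : R :=
  match s with Horizontal => t | Up | Down => 1 end.

Definition path_weight (R : comNzRingType) (t : R) (p : seq step) : R :=
  \prod_(s <- p) step_weight t s.

(* Every step advances the abscissa by at least 1, so bounding the number of
   steps by m in total_weight discards no path. *)
Lemma size_path_le m p : is_path_to m p -> (size p <= m)%N.
Proof.
case/andP=> /eqP endp _.
have : (size p)%:Z <= (endpoint p).1.
  rewrite /endpoint; elim: p {endp} => [|s p IHp]; first by rewrite big_nil.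
  rewrite big_cons /= -add1n PoszD; apply: lerD IHp.
  by case: s.
by rewrite endp.
Qed.

(* f(m, t, 2) *)
Definition total_weight (R : comNzRingType) (t : R) (m : nat) : R :=
  \sum_(k < m.+1) \sum_(p : k.-tuple step | is_path_to m p) path_weight t p.

(* Rows and columns are indexed from 0, so the index i + j - 2 becomes i + j. *)
Definition hankel (R : comNzRingType) (t : R) (n : nat) : 'M[R]_n :=
  \matrix_(i < n, j < n) total_weight t (i + j).

(* Main.v *)
Require Import Defs.
From HB Require Import structures.
From mathcomp Require Import all_boot all_order all_algebra.
From mathcomp Require Import ring zify.

Set Implicit Arguments.
Unset Strict Implicit.
Unset Printing Implicit Defensive.

Import Order.TTheory GRing.Theory Num.Theory.
Local Open Scope ring_scope.

(** Write [u = 1 + t].  The generating series [F] of the numbers [f(m, t, 2)]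
is the solution of [F = 1 + t x^2 F + x^2 F^2].  If [G] is the solution of
[G = 1 + x^2 (u G - t) G], then [u G - t] satisfies the equation of [F], so that
[F = u G - t] and
[[
   F = 1 + u x^2 F G        and        G = 1 + x^2 F G,
]]
that is, [F = 1 / (1 - u x^2 G)] and [G = 1 / (1 - x^2 F)].  Hence [F] is the
continued fraction
[[
   1 / (1 - u x^2 / (1 - x^2 / (1 - u x^2 / (1 - x^2 / ...)))),
]]
which counts Dyck paths whose down steps have weight [u] when they end at even
height and weight [1] when they end at odd height ([dyck_moment]).

For any weights [b] of the down steps, the two operators that make up a step
of a Dyck path, going up and going down, are adjoint for the diagonal form whose
value at height [k] is [b 0 * ... * b (k - 1)] ([below_adjoint]).  Moving steps
from one argument of that form to the other shows that the Hankel matrix of the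
Dyck moments is [L D L^T], where row [i] of [L] counts the path prefixes of
length [i] by their final height, and [D] is this form ([dyck_convolution]).
Since [L] is lower unitriangular, the determinant is the product of the diagonal
of [D].  Its entry at height [k] is [u] to the number of even integers below
[k], and summing these exponents over [k < n] gives the floor of [n^2 / 4].

The passage from [F] to paths uses no decomposition of paths at their returns
to the axis.  Paths that end at height [h] obey a linear recurrence in their
last step, a linear recurrence determines its solution ([walk_series]), and
explicit products of powers of [x], [F] and [G] solve the two recurrences
that are needed.  All series are polynomials read modulo [x^N]: they are
exact up to an explicit multiple of [x^N]. *)

(** * Weighted walks and linear recurrences *)

(** [below S h] is the contribution of the walks that reach height [h] by an up
step; height [0] receives nothing in this way. *)
Definition below (V : nmodType) (S : nat -> V) (h : nat) : V :=
  if h is h'.+1 then S h' else 0.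

Section Walks.
Variable R : comNzRingType.
Implicit Types (b : nat -> R) (t : R) (S : nat -> {poly R}).

(** The effect of appending one step: an up step, a down step that ends at height
[h], with weight [b h], or a horizontal step of length 2 and weight [t].  The
exponent of ['X] is the abscissa. *)
Definition transfer b t S (h : nat) : {poly R} :=
  'X * below S h + (b h)%:P * 'X * S h.+1 + t%:P * 'X^2 * S h.

Definition walk b t (k : nat) : nat -> {poly R} :=
  iter k (transfer b t) (fun h => (h == 0)%:R).

(** A fixed point of the recurrence is the sum of its iterates: the difference
between the two sides is multiplied by ['X] at each application of the
transfer operator, so after [K] steps it is a multiple of ['X^K].  Any guess for the
generating series of walks by final height is thus proved by substituting it
into the recurrence. *)
Lemma walk_series b t (N : nat) S :
    (forall h, exists r, S h = (h == 0)%:R + transfer b t S h + 'X^N * r) ->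
  forall K h, (K <= N)%N -> exists r, S h = \sum_(k < K) walk b t k h + 'X^K * r.
Proof.
move=> fixS; elim=> [|K IHK] h leKN.
  by exists (S h); rewrite big_ord0 add0r mul1r.
have [r Sh] := fixS h.
have [r0 S0] : exists r, below S h =
    \sum_(k < K) below (walk b t k) h + 'X^K * r.
  case: h {Sh} => [|h] /=; last exact: IHK (ltnW leKN).
  by exists 0; rewrite big1 // mulr0 addr0.
have [r1 S1] := IHK h.+1 (ltnW leKN).
have [r2 S2] := IHK h (ltnW leKN).
exists (r0 + (b h)%:P * r1 + t%:P * 'X * r2 + 'X^(N - K.+1) * r).
rewrite big_ord_recl Sh /transfer S0 S1 S2 -{1}(subnK leKN) exprD.
have -> : \sum_(i < K) walk b t (lift ord0 i) h =
    'X * (\sum_(k < K) below (walk b t k) h)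
    + (b h)%:P * 'X * (\sum_(k < K) walk b t k h.+1)
    + t%:P * 'X^2 * \sum_(k < K) walk b t k h.
  by rewrite !mulr_sumr -!big_split.
by rewrite (exprS _ K) [walk b t ord0 h]/=; ring.
Qed.

End Walks.

(** * Lattice paths as walks *)

Section SchroederPaths.
Variables (R : comNzRingType) (t : R).

Definition path_gf (k h : nat) : {poly R} :=
  \sum_(p : k.-tuple step | never_below_axis p && ((endpoint p).2 == h%:Z))
     (path_weight t p)%:P * 'X^(`|(endpoint p).1|).

Lemma endpoint_rcons p s : endpoint (rcons p s) = endpoint p + step_vector s.
Proof. by rewrite /endpoint big_rcons /= addrC. Qed.

Lemma endpoint_ge0 p : 0 <= (endpoint p).1.
Proof.
rewrite /endpoint; elim: p => [|s p IHp]; first by rewrite big_nil.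
by rewrite big_cons addr_ge0 //; case: s.
Qed.

Lemma path_weight_rcons p s :
  path_weight t (rcons p s) = path_weight t p * step_weight t s.
Proof. by rewrite /path_weight big_rcons /= mulrC. Qed.

Lemma never_below_rcons p s :
  never_below_axis (rcons p s) =
  never_below_axis p && (0 <= (endpoint (rcons p s)).2).
Proof.
rewrite /never_below_axis size_rcons -addn1 iotaD all_cat add0n all_seq1.
congr andb; last by rewrite take_oversize // size_rcons.
apply: eq_in_all => k; rewrite mem_iota add0n /= ltnS => lekp.
by rewrite -cats1 takel_cat.
Qed.

Lemma never_below_endpoint p : never_below_axis p -> 0 <= (endpoint p).2.
Proof.
move/allP/(_ (size p)); rewrite take_size; apply.
by rewrite mem_iota add0n ltnS leqnn.
Qed.

Lemma sum_steps (f : step -> {poly R}) :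
  \sum_s f s = f Up + f Down + f Horizontal.
Proof.
rewrite (bigD1 Up) //= (bigD1 Down) //= (bigD1 Horizontal) //= big1 ?addr0 ?addrA //.
by case.
Qed.

(** Splitting off the last step, rather than the first one, keeps all the other
prefixes of the path unchanged, and so the positivity condition too. *)
Lemma sum_tuple_rcons k (P : pred (seq step)) (f : seq step -> {poly R}) :
  \sum_(p : k.+1.-tuple step | P p) f p =
  \sum_s \sum_(p : k.-tuple step | P (rcons p s)) f (rcons p s).
Proof.
rewrite pair_big_dep /=.
rewrite (reindex (fun q : step * k.-tuple step => [tuple of rcons q.2 q.1])) //=.
apply: onW_bij; apply: inj_card_bij.
  by move=> [s p] [u q] /(congr1 val) /= /rcons_inj [/val_inj -> ->].
by rewrite card_prod !card_tuple expnS.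
Qed.

Lemma path_gfS k h :
  path_gf k.+1 h = transfer (fun=> 1) t (path_gf k) h.
Proof.
rewrite /path_gf [LHS](@sum_tuple_rcons k
  (fun p => never_below_axis p && ((endpoint p).2 == h%:Z))
  (fun p => (path_weight t p)%:P * 'X^(`|(endpoint p).1|))) sum_steps /transfer.
congr (_ + _ + _).
- case: h => [|h] /=; rewrite ?mulr0.
    (* An up step cannot end on the axis: it would start at height -1. *)
    apply: big_pred0 => p; apply/negbTE/negP => /andP[].
    rewrite never_below_rcons endpoint_rcons => /andP[/never_below_endpoint + _ /=].
    by move=> ? /eqP; lia.
  rewrite mulr_sumr; apply: eq_big => p.
    rewrite never_below_rcons endpoint_rcons /=.
    by case: never_below_axis => //=; lia.
  rewrite path_weight_rcons endpoint_rcons /= mulr1 => _.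
  have := endpoint_ge0 p; case: (endpoint p) => -[] //= m _ _.
  by rewrite addn1 exprS mulrCA.
- rewrite mul1r mulr_sumr; apply: eq_big => p.
    rewrite never_below_rcons endpoint_rcons /=.
    by case: never_below_axis => //=; lia.
  rewrite path_weight_rcons endpoint_rcons /= mulr1 => _.
  have := endpoint_ge0 p; case: (endpoint p) => -[] //= m _ _.
  by rewrite addn1 exprS mulrCA.
- rewrite mulr_sumr; apply: eq_big => p.
    rewrite never_below_rcons endpoint_rcons /=.
    by case: never_below_axis => //=; lia.
  rewrite path_weight_rcons endpoint_rcons /= => _.
  have := endpoint_ge0 p; case: (endpoint p) => -[] //= m _ _.
  by rewrite addn2 !exprS expr0 polyCM; ring.
Qed.

Lemma path_gf0 h : path_gf 0 h = (h == 0)%:R.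
Proof.
rewrite /path_gf big_mkcond (big_pred1 [tuple]) => [|p]; last first.
  by apply/esym/eqP; rewrite [p]tuple0.
rewrite /never_below_axis /path_weight /endpoint /= !big_nil /= mulr1.
by case: h.
Qed.

Lemma path_gfE k h : path_gf k h = walk (fun=> 1) t k h.
Proof.
elim: k h => [|k IHk] h; first exact: path_gf0.
rewrite path_gfS /walk iterS /transfer !IHk; congr ('X * _ + _ + _).
by case: h.
Qed.

Lemma total_weightE m :
  total_weight t m = (\sum_(k < m.+1) walk (fun=> 1) t k 0)`_m.
Proof.
rewrite coef_sum; apply: eq_bigr => k _.
rewrite -path_gfE coef_sum [LHS]big_mkcond [RHS]big_mkcond.
apply: eq_bigr => p _; rewrite coefCM coefXn /is_path_to.
have := endpoint_ge0 p; case: (endpoint p) => -[] //= w h _.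
rewrite [(_, _) == _]/eq_op /= eqz_nat [m == _]eq_sym andbC.
by case: eqP => _; case: (never_below_axis p); case: eqP => _ //=; rewrite (mulr0, mulr1).
Qed.

End SchroederPaths.

(** * Dyck paths and the LDU decomposition *)

Section DyckTriangle.
Variables (R : comNzRingType) (b : nat -> R).

(** The weight of the paths with [m] steps up or down, from height [0] to height
[k], in which a down step that ends at height [h] has weight [b h]. *)
Fixpoint dyck (m k : nat) : R :=
  if m is m'.+1 then
    below (dyck m') k + b k * dyck m' k.+1
  else (k == 0)%:R.

Lemma walk_dyck m k : walk b 0 m k = (dyck m k)%:P * 'X^m.
Proof.
elim: m k => [|m IHm] k.
  by rewrite mulr1 /=; case: (k == 0).
rewrite /walk iterS /transfer -/(walk b 0 m) !IHm.
have -> : below (walk b 0 m) k = (below (dyck m) k)%:P * 'X^m.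
  by case: k => [|k] /=; rewrite ?IHm // mul0r.
by rewrite [dyck m.+1 k]/= (exprS _ m) polyC0 polyCD polyCM; ring.
Qed.

Lemma dyck_gt m k : (m < k)%N -> dyck m k = 0.
Proof.
elim: m k => [|m IHm] [|k] //= ltmk.
by rewrite !IHm ?mulr0 ?addr0 //; apply/leqW/ltnW.
Qed.

Lemma dyck_diag m : dyck m m = 1.
Proof. by elim: m => [//|m IHm] /=; rewrite IHm dyck_gt ?mulr0 ?addr0. Qed.

(** The squared norm of the [k]th monic orthogonal polynomial for the linear
functional with moments [dyck m 0]. *)
Definition norm2 (k : nat) : R := \prod_(h < k) b h.

(** Both sums pair [u] at height [k] with [v] at height [k + 1], with coefficient
[norm2 k.+1 = norm2 k * b k].  The hypothesis removes the one term, with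
[k = n], that the shift of indices pushes out of the range of summation. *)
Lemma below_adjoint n (u v : nat -> R) : u n * v n.+1 = 0 ->
  \sum_(k < n.+1) below u k * norm2 k * v k =
  \sum_(k < n.+1) u k * norm2 k * (b k * v k.+1).
Proof.
move=> uv0; rewrite big_ord_recl /= !mul0r add0r big_ord_recr /=.
have -> : u n * norm2 n * (b n * v n.+1) = 0.
  by rewrite [b n * _]mulrC mulrACA uv0 mul0r.
rewrite addr0; apply: eq_bigr => k _.
by rewrite /norm2 big_ord_recr /= !mulrA.
Qed.

(** A path of length [i + j] that returns to the axis is cut after [i] steps.
Reading the second part backwards turns up steps into down steps, and
[norm2 k] is the resulting change of weight.  The proof moves one step at a time
from the first part to the second by [below_adjoint]; the hypothesis says that
the range of summation contains all the heights that [i] steps can reach. *)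
Lemma dyck_convolution i j n : (i < n)%N ->
  \sum_(k < n) dyck i k * norm2 k * dyck j k = dyck (i + j) 0.
Proof.
elim: i j n => [|i IHi] j [|n] // ltin.
  rewrite big_ord_recl big1 => [|k _]; last by rewrite /= !mul0r.
  by rewrite addr0 /norm2 big_ord0 !mul1r.
have lt_in : (i < n)%N := ltin.
rewrite addSnnS -(IHi j.+1 n.+1 (ltnW ltin)) /=.
under eq_bigr do rewrite !mulrDl.
under [RHS]eq_bigr do rewrite mulrDr.
rewrite !big_split /= addrC below_adjoint; last by rewrite (dyck_gt lt_in) mul0r.
congr (_ + _).
transitivity (\sum_(k < n.+1) below (dyck j) k * norm2 k * dyck i k).
  rewrite below_adjoint; first by apply: eq_bigr => k _; ring.
  by rewrite (@dyck_gt i) ?mulr0 // leqW.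
by apply: eq_bigr => k _; ring.
Qed.

End DyckTriangle.

(** * The continued fraction *)

Section ContinuedFraction.
Variables (R : comNzRingType) (t : R).

Definition step_down (h : nat) : R := if odd h then 1 else 1 + t.

(** Iterating the map on the right-hand side gains a factor ['X^2] at each step,
because a difference of two of its values is ['X^2] times a multiple of the
difference of its arguments; a single factor ['X] is kept. *)
Lemma continued_fraction_fixpoint n : exists G r : {poly R},
  G = 1 + 'X^2 * ((1 + t)%:P * G - t%:P) * G + 'X^n * r.
Proof.
pose T (G : {poly R}) := 1 + 'X^2 * ((1 + t)%:P * G - t%:P) * G.
suff [G [r Gr]] : exists G r, G = T G + 'X^n * r by exists G, r.
elim: n => [|n [G [r Gr]]].
  by exists 0, (- T 0); rewrite mul1r addrN.
exists (T G), ('X * r * ((1 + t)%:P * (G + T G) - t%:P)).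
have -> : T (T G) = T G + 'X^2 * ((1 + t)%:P * (T G + G) - t%:P) * (T G - G).
  by rewrite /T; ring.
have -> : T G - G = - ('X^n * r) by rewrite {2}Gr; ring.
by rewrite (exprS _ n); ring.
Qed.

(** With [F = (1 + t) G - t], the identity [(1 + t) F G = F (F + t)] makes the first
and the third equations the same; this is where the weight [1 + t] comes from. *)
Lemma schroeder_series N : exists F G r s : {poly R},
  [/\ F - (1 + (1 + t)%:P * 'X^2 * F * G) = 'X^N * r,
      G - (1 + 'X^2 * F * G) = 'X^N * s
    & F - (1 + t%:P * 'X^2 * F + 'X^2 * F ^+ 2) = 'X^N * r].
Proof.
have [G [s Gs]] := continued_fraction_fixpoint N.
pose F := (1 + t)%:P * G - t%:P.
have eG : G - (1 + 'X^2 * F * G) = 'X^N * s by rewrite {1}Gs -/F; ring.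
have eF : F - (1 + (1 + t)%:P * 'X^2 * F * G) = 'X^N * ((1 + t)%:P * s).
  by rewrite [RHS]mulrCA -eG /F polyCD polyC1; ring.
exists F, G, ((1 + t)%:P * s), s; split=> //.
by rewrite -eF /F; ring.
Qed.

(** A path that ends at height [h] consists of the last up steps to each of the
heights [1], ..., [h] and of [h + 1] paths that return to their starting height;
this suggests the solution ['X^h * F ^+ h.+1]. *)
Lemma walk_gf_schroeder N (F r : {poly R}) :
    F - (1 + t%:P * 'X^2 * F + 'X^2 * F ^+ 2) = 'X^N * r ->
  exists q, F = \sum_(k < N) walk (fun=> 1) t k 0 + 'X^N * q.
Proof.
move=> eF; pose S h := 'X^h * F ^+ h.+1.
have [h|q] := @walk_series _ (fun=> 1) t N S _ N 0 (leqnn _); last first.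
  by rewrite {1}/S mul1r expr1; exists q.
exists ('X^h * F ^+ h * r); rewrite (mulrCA 'X^N) -eF /transfer /S polyC1.
case: h => [|h] /=; first by ring.
by rewrite !exprS; ring.
Qed.

(** The same decomposition as in [walk_gf_schroeder]: the factor for the excursions
above height [i] is now [F] for even [i] and [G] for odd [i], which gives the
exponents [h./2.+1] and [uphalf h]. *)
Lemma walk_gf_dyck N (F G r s : {poly R}) :
    F - (1 + (1 + t)%:P * 'X^2 * F * G) = 'X^N * r ->
    G - (1 + 'X^2 * F * G) = 'X^N * s ->
  exists q, F = \sum_(k < N) walk step_down 0 k 0 + 'X^N * q.
Proof.
move=> eF eG; pose S h := 'X^h * F ^+ h./2.+1 * G ^+ uphalf h.
have [h|q] := @walk_series _ step_down 0 N S _ N 0 (leqnn _); last first.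
  by rewrite {1}/S mul1r expr1 mulr1; exists q.
rewrite /transfer /S polyC0 /step_down.
case: h => [|h] /=; first by exists r; rewrite -eF; ring.
rewrite if_neg uphalf_half; case: (odd h); rewrite !(add0n, add1n).
  exists ('X^(h.+1) * F ^+ h./2.+1 * G ^+ h./2.+1 * r).
  by rewrite (mulrCA 'X^N) -eF !exprS; ring.
exists ('X^(h.+1) * F ^+ h./2.+1 * G ^+ h./2 * s).
by rewrite (mulrCA 'X^N) -eG polyC1 !exprS; ring.
Qed.

Lemma dyck_moment m : dyck step_down m 0 = total_weight t m.
Proof.
have [F [G [r [s [eF eG eS]]]]] := schroeder_series m.+1.
have [q Fq] := walk_gf_schroeder eS.
have [p Fp] := walk_gf_dyck eF eG.
have := congr1 (coefp m) (etrans (esym Fp) Fq); rewrite /= !coefD.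
rewrite !coefXnM ltnSn !addr0 total_weightE => <-.
rewrite coef_sum (bigD1 ord_max) //= walk_dyck coefCM coefXn eqxx mulr1.
rewrite big1 ?addr0 // => k; rewrite -val_eqE /= => neq_km.
by rewrite walk_dyck coefCM coefXn eq_sym (negbTE neq_km) mulr0.
Qed.

(** [uphalf k] is the number of even heights below [k]. *)
Lemma norm2_step_down k : norm2 step_down k = (1 + t) ^+ uphalf k.
Proof.
rewrite /norm2; elim: k => [|k IHk]; first by rewrite big_ord0.
rewrite big_ord_recr IHk /= /step_down uphalf_half.
by case: (odd k); rewrite ?mulr1 // -exprSr.
Qed.

Lemma hankel_factor n :
  hankel t n = (\matrix_(i, k) dyck step_down i k)
     *m diag_mx (\row_k norm2 step_down k)
     *m (\matrix_(i < n, k < n) dyck step_down i k)^T.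
Proof.
apply/matrixP => i j; rewrite !mxE -dyck_moment -(dyck_convolution _ _ (ltn_ord i)).
by apply: eq_bigr => k _; rewrite mul_mx_diag !mxE.
Qed.

End ContinuedFraction.

Lemma sum_uphalf n : (\sum_(k < n) uphalf k = n ^ 2 %/ 4)%N.
Proof.
elim: n => [|n IHn]; first by rewrite big_ord0.
rewrite big_ord_recr IHn /=; nia.
Qed.

Theorem proposition1p2 (R : comNzRingType) (t : R) (n : nat) :
  \det (hankel t n) =
    if ~~ odd n then (1 + t) ^+ ((n ^ 2) %/ 4)
    else (1 + t) ^+ (((n - 1) * (n + 1)) %/ 4).
Proof.
have det_dyck : \det (\matrix_(i < n, k < n) dyck (step_down t) i k) = 1.
  rewrite det_trig; last first.
    by apply/is_trig_mxP => i k ltik; rewrite mxE dyck_gt.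
  by rewrite big1 // => i _; rewrite mxE dyck_diag.
rewrite hankel_factor !det_mulmx det_tr det_dyck det_diag mul1r mulr1.
under eq_bigr do rewrite mxE norm2_step_down.
rewrite prodrXr sum_uphalf; case: ifP => // odd_n; congr (_ ^+ _); nia.
Qed.
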